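(* Assuming classical logic, there is no continuous functional that takes codes for two continuous injections $f, g : 2 \times \mathbb{N}_\infty \to 2 \times \mathbb{N}_\infty$ to codes for a bijection $h : 2 \times \mathbb{N}_\infty \to 2 \times \mathbb{N}_\infty$ and its inverse $h^{-1}$ such that $h \subseteq \bigcup_{m \in \mathbb{Z}} R^{f,g}_m$.
   Context: $\mathbb{N}_\infty \subseteq 2^{\mathbb{N}}$ is the set of bit sequences containing at most one $1$, with the subspace topology; $2 = \{0,1\}$ is discrete. $2 \times \mathbb{N}_\infty$ is regarded as a subset of $\mathbb{N}^{\mathbb{N}}$ via $(i,x) \mapsto i x$ (prepending $i$ to $x$). Codes are those of type-2 computability (Kleene's second algebra): an $e \in \mathbb{N}^{\mathbb{N}}$ codes the partial continuous function $q \mapsto e \cdot q$ on $\mathbb{N}^{\mathbb{N}}$, where $(e\cdot q)(n) = e(\langle n, q_0, \ldots, q_{k-1}\rangle) - 1$ for the least $k$ such that $e(\langle n, q_0,\ldots,q_{k-1}\rangle) > 0$ ($\langle\cdots\rangle$ being a fixed coding of finite sequences of naturals as naturals), and $e \cdot q$ is defined iff such a $k$ exists for all $n$. $e$ is a code for $F : 2 \times \mathbb{N}_\infty \to 2\times \mathbb{N}_\infty$ if $e \cdot z$ is defined and equal to $F(z)$ for all $z \in 2 \times \mathbb{N}_\infty$. A continuous functional as in the claim is a partial continuous map $\mathbb{N}^{\mathbb{N}} \times \mathbb{N}^{\mathbb{N}} \rightharpoonup \mathbb{N}^{\mathbb{N}} \times \mathbb{N}^{\mathbb{N}}$ defined at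 least on all pairs of codes for continuous injections; the resulting $h$ may depend on the codes and not only on $f$ and $g$. For injections $f, g : X \to X$ and $m \in \mathbb{Z}$, $R^{f,g}_m \subseteq X \times X$ is the partial injection $f \circ (g \circ f)^m$: for $m \ge 0$, $(x,y) \in R^{f,g}_m$ iff $y = f((g\circ f)^m(x))$; for $m < 0$, $(x,y) \in R^{f,g}_m$ iff $x = g((f \circ g)^{-m-1}(y))$. Functions are identified with their graphs. *)

(* Defs.v *)
(* MathComp / MathComp-Analysis. *)
From HB Require Import structures.
From mathcomp Require Import all_boot all_order all_algebra.
From mathcomp Require Import all_classical all_reals topology cantor.

Set Implicit Arguments.
Unset Strict Implicit.
Unset Printing Implicit Defensive.

Local Open Scope classical_set_scope.

(* N^N with the product of the discrete topologies. *)
Definition baire_space : Type := prod_topology (fun _ : nat => nat).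

HB.instance Definition _ := Pointed.on baire_space.
HB.instance Definition _ := Nbhs.on baire_space.
HB.instance Definition _ := Topological.on baire_space.

(* Coerced to a type, a set carries the subspace topology. *)
Definition Ninfty : set cantor_space :=
  [set x : cantor_space | forall i j : nat, x i = true -> x j = true -> i = j].

(* bool is the discrete space 2; the product carries the product topology. *)
Definition two_Ninfty : Type := (bool * Ninfty)%type.

HB.instance Definition _ := Nbhs.on two_Ninfty.
HB.instance Definition _ := Topological.on two_Ninfty.

(* The inclusion (i, x) |-> ix of 2 x N_oo into N^N. *)
Definition embed (z : two_Ninfty) : baire_space :=
  fun n => if n is k.+1 then nat_of_bool (set_val z.2 k) else nat_of_bool z.1.

(* [kleene_app e q r]: e . q is defined and equal to r. The coding of finite
   sequences is the bijection [CodeSeq.code : seq nat -> nat], and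
   [mkseq q k] is [:: q 0; ...; q k.-1]. *)
Definition kleene_app (e q r : baire_space) : Prop :=
  forall n : nat, exists k : nat,
    [/\ forall j : nat, (j < k)%N -> e (CodeSeq.code (n :: mkseq q j)) = 0%N,
        (0 < e (CodeSeq.code (n :: mkseq q k)))%N
      & r n = (e (CodeSeq.code (n :: mkseq q k)) - 1)%N].

Definition is_code (e : baire_space) (F : two_Ninfty -> two_Ninfty) : Prop :=
  forall z : two_Ninfty, kleene_app e (embed z) (embed (F z)).

(* The partial injection f o (g o f)^m for m in Z; [Negz n] is -(n + 1), so
   that -m - 1 = n when m = Negz n. *)
Definition Rel {X : Type} (f g : X -> X) (m : int) : set (X * X) :=
  match m with
  | Posz n => [set xy | xy.2 = f (iter n (g \o f) xy.1)]
  | Negz n => [set xy | xy.1 = g (iter n (f \o g) xy.2)]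
  end.

Definition graph {X Y : Type} (h : X -> Y) : set (X * Y) :=
  [set xy | xy.2 = h xy.1].

(* Main.v *)
(** The isolated points of [2 x N_oo] are listed by the integers, those with
    first bit 0 being negative, so that they accumulate at one point at infinity
    on each side. Take [f = id] and [g = k |-> k + 1]. The two-sided chain
    formed by all isolated points can be cut at a far away position [-K], either
    so that it starts in the domain of [f] or so that it starts in the domain of
    [g]. Both cuts converge to [(f, g)] as [K] grows. By continuity and
    compactness of [2 x N_oo], for large [K] the bijections [h1], [h2] obtained
    for the two cuts have the same first bit everywhere. But [h1] preserves
    [{k >= -K}] while [h2] maps [{k > -K}] onto [{k >= -K}], so the finite set
    [{-K <= k < 0}] pulls back along [h1] to a set with exactly one more element
    than along [h2]. *)
Require Import Defs.
From HB Require Import structures.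
From mathcomp Require Import all_boot all_order all_algebra.
From mathcomp Require Import all_classical all_reals topology cantor.
From mathcomp Require Import zify.

Set Implicit Arguments.
Unset Strict Implicit.
Unset Printing Implicit Defensive.

Local Open Scope classical_set_scope.

(** * Coordinatewise neighbourhoods in products of discrete spaces *)

Lemma cvg_prod_discrete (T : discreteTopologicalType)
    (F : set_system (prod_topology (fun _ : nat => T)))
    (x : prod_topology (fun _ : nat => T)) :
  Filter F -> (forall n, F [set y | y n = x n]) -> F --> x.
Proof.
move=> FF Fx; apply/cvg_sup => n A [_ [[B _ <-] Bx] BA].
by apply: filterS (Fx n) => y /= yx; apply: BA => /=; rewrite yx.
Qed.

Lemma nbhs_coord (T : discreteTopologicalType)
    (x : prod_topology (fun _ : nat => T)) (n : nat) :
  nbhs x [set y | y n = x n].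
Proof.
exact: (@proj_continuous nat (fun _ => T) n x [set x n] (discrete_set1 _)).
Qed.

Definition agree (T : Type) (n : nat) (x y : nat -> T) :=
  forall i, (i < n)%N -> x i = y i.

Lemma near_agree (T : Type) (F : set_system T) (U : Type) (u : T -> nat -> U)
    (x : nat -> U) (n : nat) :
  Filter F -> (forall i, F [set t | u t i = x i]) ->
  F [set t | agree n (u t) x].
Proof.
move=> FF Fx; elim: n => [|n IHn]; first exact: filterE.
apply: filterS2 IHn (Fx n) => t /= ag tn i.
by rewrite ltnS leq_eqVlt => /predU1P[->|/ag].
Qed.

Lemma embed_nbhs (z : two_Ninfty) (n : nat) :
  nbhs z [set z' | embed z' n = embed z n].
Proof.
case: z => b x; case: n => [|n].
  have : nbhs (b, x) (fst @^-1` [set b]).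
    by apply: (@cvg_fst _ _ (nbhs b) (nbhs x)); exact: discrete_set1.
  by apply: filterS => -[b' x'] /= ->.
have : nbhs (b, x) (snd @^-1` (set_val @^-1`
    [set y : cantor_space | y n = set_val x n])).
  apply: (@cvg_snd _ _ (nbhs b) (nbhs x)).
  apply: initial_continuous; exact: nbhs_coord.
by apply: filterS => -[b' x'] /= ->.
Qed.

(** * Continuous self-maps of [two_Ninfty] and canonical codes for them *)

Definition pointwise_modulus (F : two_Ninfty -> two_Ninfty) :=
  forall z n, exists k, forall z',
    agree k (embed z') (embed z) -> embed (F z') n = embed (F z) n.

Lemma pointwise_modulus_continuous (F : two_Ninfty -> two_Ninfty) :
  pointwise_modulus F -> continuous F.
Proof.
move=> modF z.
have near_bit n : \forall z' \near z, embed (F z') n = embed (F z) n.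
  have [k Fk] := modF z n.
  by apply: filterS (near_agree k _ (embed_nbhs z)) => z' /Fk.
have cvg1 : (F z').1 @[z' --> z] --> (F z).1.
  apply/discrete_cvg; apply: filterS (near_bit 0%N) => z' /=.
  by case: (F z').1 (F z).1 => [] [].
have cvg2 : (F z').2 @[z' --> z] --> (F z).2.
  have cvgv : set_val (F z').2 @[z' --> z] --> (set_val (F z).2 : cantor_space).
    apply: cvg_prod_discrete => n; apply: filterS (near_bit n.+1) => z' /=.
    by case: (set_val (F z').2 n) (set_val (F z).2 n) => [] [].
  (* The open sets of [Ninfty] are the preimages of open sets under [set_val], so [cvgv]
     suffices. *)
  move=> A [_ [[B oB <-] Bx] BA].
  have nbB : nbhs z [set z' | B (set_val (F z').2)].
    by apply: (cvgv B); exact: open_nbhs_nbhs.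
  by apply: filterS nbB => z'; exact: BA.
move=> A nA; have : nbhs z [set z' | A ((F z').1, (F z').2)].
  exact: (cvg_pair cvg1 cvg2 nA).
by apply: filterS => z' /=; rewrite -surjective_pairing.
Qed.

(** If no point extends [s], every number is forced. This is harmless, since a code is only tested
    on prefixes of points. *)
Definition forced_values (F : two_Ninfty -> two_Ninfty) (n : nat)
    (s : seq nat) : set nat :=
  [set v | forall z, mkseq (embed z) (size s) = s -> embed (F z) n = v].

Definition code_of (F : two_Ninfty -> two_Ninfty) : baire_space := fun c =>
  if CodeSeq.decode c is n :: s then
    if `[< forced_values F n s !=set0 >] then (get (forced_values F n s)).+1
    else 0%N
  else 0%N.

Lemma agree_mkseq (T : Type) (n : nat) (x y : nat -> T) :
  agree n x y <-> mkseq x n = mkseq y n.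
Proof.
split=> [xy|xy i ltin].
  by apply/eq_in_map => i; rewrite mem_iota add0n => /xy.
by rewrite -(nth_mkseq (x 0%N) x ltin) xy nth_mkseq.
Qed.

(** The modulus provides a prefix of [z] that forces a value. At the least such prefix the chosen
    value is the right one, because [z] itself extends the prefix. *)
Lemma code_ofP (F : two_Ninfty -> two_Ninfty) :
  pointwise_modulus F -> is_code (code_of F) F.
Proof.
move=> modF z n.
have codeE k : code_of F (CodeSeq.code (n :: mkseq (embed z) k)) =
    if `[< forced_values F n (mkseq (embed z) k) !=set0 >] then
      (get (forced_values F n (mkseq (embed z) k))).+1 else 0%N.
  by rewrite /code_of CodeSeq.codeK.
have defined : exists k,
    (0 < code_of F (CodeSeq.code (n :: mkseq (embed z) k)))%N.
  have [k Fk] := modF z n; exists k; rewrite codeE; case: asboolP => // -[].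
  by exists (embed (F z) n) => z'; rewrite size_mkseq => /agree_mkseq/Fk.
case: (ex_minnP defined) => k pos_k min_k; exists k; split => //.
  move=> j ltjk; apply/eqP; rewrite -leqn0 leqNgt; apply/negP => /min_k.
  by rewrite leqNgt ltjk.
move: pos_k; rewrite codeE; case: asboolP => // /getPex forced _.
by rewrite subn1 /=; apply: forced; rewrite size_mkseq.
Qed.

(** An entry of the code at [n :: s] depends only on the [n]-th coordinates of the values. Once
    these agree everywhere, the sets of forced values are equal, and so are the choices made by
    [get]. *)
Lemma code_of_cvg (F : nat -> two_Ninfty -> two_Ninfty)
    (G : two_Ninfty -> two_Ninfty) :
  (forall n, \forall K \near \oo, forall z, embed (F K z) n = embed (G z) n) ->
  code_of (F K) @[K --> \oo] --> code_of G.
Proof.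
move=> FG; apply: cvg_prod_discrete => c.
suff : \forall K \near \oo, code_of (F K) c = code_of G c by [].
rewrite /code_of; case: (CodeSeq.decode c) => [|n s]; first exact: nearW.
apply: filterS (FG n) => K FGK.
suff -> : forced_values (F K) n s = forced_values G n s by [].
by apply/seteqP; split=> v /= Hv z /Hv; rewrite FGK.
Qed.

(** * The points as integers and two limits *)

Lemma delta_in_Ninfty (o : option nat) :
  ((fun i => o == Some i) : cantor_space) \in Ninfty.
Proof. by apply/mem_set => i j /eqP-> /eqP[]. Qed.

Definition delta (o : option nat) : Ninfty :=
  @exist _ (fun x => x \in Ninfty) _ (delta_in_Ninfty o).

Definition side (p : int + bool) : bool :=
  match p with inl k => (0 <= k)%R | inr b => b end.

Definition index (p : int + bool) : option nat :=
  match p with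
  | inl (Posz n) | inl (Negz n) => Some n
  | inr _ => None
  end.

(* [inl k] lists the isolated points, with [-n - 1] and [n] standing for the
   points of index [n] on either side; [inr b] is the limit point [(b, oo)]. *)
Definition pt (p : int + bool) : two_Ninfty := (side p, delta (index p)).

Lemma embed_ptS (p : int + bool) (n : nat) :
  embed (pt p) n.+1 = (index p == Some n) :> nat.
Proof. by rewrite /= set_valE. Qed.

Lemma side_index_inj (p q : int + bool) :
  side p = side q -> index p = index q -> p = q.
Proof.
by case: p q => [[m|m]|b] [[n|n]|c] //= sd id; congruence.
Qed.

Lemma pt_inj : injective pt.
Proof.
move=> p q epq; apply: side_index_inj; first by have [] := epq.
have idx n : (index p == Some n) = (index q == Some n).
  have := congr1 (fun z => embed z n.+1) epq.
  by rewrite !embed_ptS; case: eqP; case: eqP.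
case: (index p) (index q) idx => [m|] [n|] // => [/(_ m)|/(_ m)|/(_ n)].
- by rewrite eqxx => /esym/eqP ->.
- by rewrite eqxx.
- by rewrite eqxx.
Qed.

Lemma pt_surj (z : two_Ninfty) : exists p, pt p = z.
Proof.
have [o oz] : exists o, delta o = z.2.
  have [[n zn]|no] := pselect (exists n, set_val z.2 n = true).
    exists (Some n); apply/val_inj/funext => i; rewrite -!set_valE /=.
    apply/eqP/idP => [[<-]//|zi].
    by have zN := set_valP z.2; congr Some; exact: zN.
  exists None; apply/val_inj/funext => i; rewrite -!set_valE /=.
  by apply/esym/negP => zi; apply: no; exists i.
case: z oz => -[] x /= <-; case: o => [n|].
- by exists (inl (Posz n)).
- by exists (inr true).
- by exists (inl (Negz n)).
- by exists (inr false).
Qed.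

Definition loc (z : two_Ninfty) : int + bool := sval (cid (pt_surj z)).

Lemma locK : cancel loc pt.
Proof. by move=> z; rewrite /loc; case: cid. Qed.

Lemma ptK : cancel pt loc.
Proof. by move=> p; apply: pt_inj; rewrite locK. Qed.

Lemma side_loc (z : two_Ninfty) : side (loc z) = z.1.
Proof. by rewrite -{2}(locK z). Qed.

(** * Compactness and uniform control of the first bit *)

Definition far (n : nat) (p : int + bool) :=
  forall j, (j < n)%N -> index p <> Some j.

Lemma far_agree (n : nat) (p q : int + bool) :
  side p = side q -> far n p -> far n q ->
  agree n.+1 (embed (pt p)) (embed (pt q)).
Proof.
move=> sd fp fq [_|i]; first by rewrite /= sd.
rewrite ltnS !embed_ptS => ltin.
by rewrite (introF eqP (fp _ ltin)) (introF eqP (fq _ ltin)).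
Qed.

Lemma agree_side (n : nat) (p q : int + bool) :
  agree n.+1 (embed (pt p)) (embed (pt q)) -> side p = side q.
Proof. by move=> /(_ 0%N isT) /=; case: (side p) (side q) => [] []. Qed.

Lemma agree_index (n j : nat) (p q : int + bool) :
  agree n.+1 (embed (pt p)) (embed (pt q)) -> (j < n)%N ->
  (index p == Some j) = (index q == Some j).
Proof.
move=> ag ltjn; have := ag j.+1 ltjn; rewrite !embed_ptS.
by case: eqP; case: eqP.
Qed.

(** Compactness by hand: neighbourhoods of the two limit points leave out only finitely many
    isolated points, and by monotonicity the maximum of the finitely many bounds works
    everywhere. *)
Lemma locally_uniformly (P : two_Ninfty -> nat -> Prop) :
  (forall z m n, (m <= n)%N -> P z m -> P z n) ->
  (forall z, exists k M, forall z', agree k (embed z') (embed z) -> P z' M) ->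
  exists M, forall z, P z M.
Proof.
move=> monoP locP.
have [k0 [M0 P0]] := locP (pt (inr false)).
have [k1 [M1 P1]] := locP (pt (inr true)).
have [M2 P2] : exists M, forall j, (j < maxn k0 k1)%N ->
    P (pt (inl (Posz j))) M /\ P (pt (inl (Negz j))) M.
  elim: (maxn k0 k1) => [|n [M PM]]; first by exists 0%N.
  have [k [Mp Pp]] := locP (pt (inl (Posz n))).
  have [k' [Mn Pn]] := locP (pt (inl (Negz n))).
  exists (maxn M (maxn Mp Mn)) => j; rewrite ltnS leq_eqVlt => /predU1P[->|].
    split; [apply: (monoP _ Mp (maxn M (maxn Mp Mn))); last exact: Pp
           |apply: (monoP _ Mn (maxn M (maxn Mp Mn))); last exact: Pn]; lia.
  move=> /PM[]; have leM : (M <= maxn M (maxn Mp Mn))%N by lia.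
  by split; exact: monoP leM _.
exists (maxn M2 (maxn M0 M1)) => z; rewrite -(locK z); move: (loc z) => p.
have [farp|] := pselect (far (maxn k0 k1) p).
  have agp : agree (maxn k0 k1).+1 (embed (pt p)) (embed (pt (inr (side p)))).
    exact: far_agree.
  case: (side p) agp => agp.
    apply: (monoP _ M1); first by lia.
    by apply: P1 => i ltik; apply: agp; lia.
  apply: (monoP _ M0); first by lia.
  by apply: P0 => i ltik; apply: agp; lia.
move=> /existsNP[j /not_implyP[ltj /contrapT]].
have leM : (M2 <= maxn M2 (maxn M0 M1))%N by lia.
have [Pp Pn] := P2 j ltj.
by case: p => [[m|m]|b] //= [->]; exact: monoP leM _.
Qed.

(** The positive entry at [k] stops the search in [e] by stage [k]. As [e'] has the same entries up
    to there, both searches stop at the same stage. *)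
Lemma kleene_app_eq (e e' q r r' : baire_space) (n k : nat) :
  kleene_app e q r -> kleene_app e' q r' ->
  (0 < e (CodeSeq.code (n :: mkseq q k)))%N ->
  (forall j, (j <= k)%N -> e' (CodeSeq.code (n :: mkseq q j)) =
                           e (CodeSeq.code (n :: mkseq q j))) ->
  r' n = r n.
Proof.
move=> /(_ n)[i [zero pos ->]] /(_ n)[i' [zero' pos' ->]] posk ee'.
have leik : (i <= k)%N.
  by rewrite leqNgt; apply/negP => /zero ek; rewrite ek in posk.
case: (ltngtP i' i) => [lti|lti|->]; last by rewrite ee'.
  by move: pos'; rewrite (ee' _ (leq_trans (ltnW lti) leik)) (zero _ lti) ltnn.
by move: pos; rewrite -ee' // (zero' _ lti) ltnn.
Qed.

Lemma first_bit_locally_constant (e : baire_space)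
    (h : two_Ninfty -> two_Ninfty) :
  is_code e h -> exists M, forall e' h', is_code e' h' -> agree M e' e ->
    forall z, (h' z).1 = (h z).1.
Proof.
move=> codeh.
pose P z M := forall e' h', is_code e' h' -> agree M e' e ->
  (h' z).1 = (h z).1.
have [|z|M PM] := @locally_uniformly P.
- move=> z m n lemn Pm e' h' codeh' ag; apply: (Pm e') => // i ltim.
  by apply: ag; exact: leq_trans lemn.
- have [k [_ pos _]] := codeh z 0%N.
  (* The bound exceeds every position of [e] consulted for the first bit at [z]; points sharing [k]
     coordinates with [z] consult the same positions. *)
  exists k, (\max_(j < k.+1) (CodeSeq.code (0%N :: mkseq (embed z) j))).+1.
  move=> z' agz e' h' codeh' ag.
  have pre j : (j <= k)%N -> mkseq (embed z') j = mkseq (embed z) j.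
    move=> lejk; apply/agree_mkseq => i ltij; apply: agz.
    exact: leq_trans lejk.
  have : embed (h' z') 0%N = embed (h z') 0%N.
    apply: (kleene_app_eq (k := k) (codeh z') (codeh' z')).
      by rewrite pre.
    move=> j lejk; rewrite pre //; apply: ag; rewrite ltnS.
    exact: (leq_bigmax (Ordinal (lejk : (j < k.+1)%N))).
  by move=> /=; case: (h' z').1 (h z').1 => [] [].
- by exists M => e' h' codeh' ag z; exact: PM codeh' ag.
Qed.

(** * Self-maps induced by maps of the integers *)

Definition emap (psi : int -> int) (p : int + bool) : int + bool :=
  match p with inl k => inl (psi k) | inr b => inr b end.

Definition lift (psi : int -> int) (z : two_Ninfty) : two_Ninfty :=
  pt (emap psi (loc z)).

Lemma loc_lift (psi : int -> int) (z : two_Ninfty) :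
  loc (lift psi z) = emap psi (loc z).
Proof. exact: ptK. Qed.

Lemma lift_inj (psi : int -> int) : injective psi -> injective (lift psi).
Proof.
move=> psi_inj z z' /pt_inj eq_psi; apply: (can_inj locK).
case: (loc z) (loc z') eq_psi => [k|b] [k'|b'] //= eq_psi; congr inl.
by apply: psi_inj; case: eq_psi.
Qed.

(** Bounded displacement makes [lift psi] continuous at the limit points, which it fixes. *)
Definition almost_id (psi : int -> int) :=
  forall k, (k - 1 <= psi k)%R /\ (psi k <= k + 1)%R.

Lemma lift_modulus (psi : int -> int) :
  almost_id psi -> pointwise_modulus (lift psi).
Proof.
move=> psi1 z n; rewrite -(locK z); case: (loc z) => [k|b].
  (* An isolated point of index [m] is determined by its first [m.+2] coordinates: the side and the
     bits up to its 1. *)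
  exists (if k is Posz m then m.+2 else if k is Negz m then m.+2 else 0%N).
  move=> z'; rewrite -(locK z') => ag.
  suff -> : loc z' = inl k by [].
  case: k ag => m ag.
    apply: side_index_inj; first exact: agree_side ag.
    by apply/eqP; rewrite (agree_index ag).
  apply: side_index_inj; first exact: agree_side ag.
  by apply/eqP; rewrite (agree_index ag).
(* This prefix puts the index of an isolated [p] at [n.+2] or beyond, so a displacement by one
   neither changes the side nor brings the index below [n]. *)
exists n.+3 => z'; rewrite -(locK z') /lift !ptK; move: (loc z') => p ag.
have sdp := agree_side ag.
have farp : far n.+2 p.
  by move=> j ltj /eqP; rewrite (agree_index ag ltj).
suff [sdp' farp'] : side (emap psi p) = b /\ far n (emap psi p).
  by apply: (@far_agree n) => //; case: b {ag sdp sdp'}.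
case: p sdp farp {ag} => [k|c] //= sdp farp.
have [psik1 psik2] := psi1 k.
split.
  rewrite -sdp; case: k farp psik1 psik2 {sdp} => m farp.
    have : (n.+2 <= m)%N by rewrite leqNgt; apply/negP => /farp.
    by move: (psi _) => q; lia.
  have : (n.+2 <= m)%N by rewrite leqNgt; apply/negP => /farp.
  by move: (psi _) => q; lia.
move=> j ltj /=.
have : (k >= n.+2%:Z \/ k < - n.+2%:Z)%R.
  case: k farp {sdp psik1 psik2} => m farp;
  have : (n.+2 <= m)%N by rewrite leqNgt; apply/negP => /farp.
    by lia.
  by lia.
by case: (psi k) psik1 psik2 => m p1 p2 far2 [] emj; lia.
Qed.

(** Where the values differ, both are at most [-K]: they have first bit 0 and index at least
    [K - 1], so coordinate [n] does not separate them. *)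
Lemma lift_close (psi psi' : int -> int) (n K : nat) (z : two_Ninfty) :
  (forall k, psi k = psi' k \/ (psi k <= - K%:Z /\ psi' k <= - K%:Z)%R) ->
  (n < K)%N -> embed (lift psi z) n = embed (lift psi' z) n.
Proof.
move=> close ltnK; rewrite /lift; case: (loc z) => [k|b] //=.
have [->//|[]] := close k; move: (psi k) (psi' k) => q q' q1 q2.
have farq r : (r <= - K%:Z)%R -> far n (inl r).
  by case: r => m le_r j ltj [emj]; lia.
apply: (@far_agree n) => //; try exact: farq.
by rewrite /=; lia.
Qed.

(** * Counting, and invariants along chains *)

Definition up (c : int) (p : int + bool) : bool :=
  match p with inl k => (c <= k)%R | inr b => b end.

Lemma up_neg_side (K : nat) (p : int + bool) :
  up (- K%:Z)%R p -> side p = false -> exists i : 'I_K, p = inl (Negz i).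
Proof.
case: p => [[m|m]|b] /=; [by [] | | by move=> ->].
move=> le_m _; have ltm : (m < K)%N by lia.
by exists (Ordinal ltm).
Qed.

(** If the first bits agreed, [h1 \o h2'] would map the block of positions from [-K] to [-1]
    injectively, hence onto, to itself. But [h1] also sends position [-K] into the block, while [h2]
    sends it outside. *)
Lemma bijections_first_bit_differ (K : nat)
    (h1 h2 h1' h2' : two_Ninfty -> two_Ninfty) :
  cancel h1 h1' -> cancel h2 h2' -> cancel h2' h2 ->
  (forall z, up (- K%:Z)%R (loc z) = up (- K%:Z)%R (loc (h1 z))) ->
  (forall z, up (- K%:Z + 1)%R (loc z) = up (- K%:Z)%R (loc (h2 z))) ->
  ~ (forall z, (h1 z).1 = (h2 z).1).
Proof.
move=> h1K h2K h2'K up1 up2 bits.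
have [|sigma sigmaP] := @choice 'I_K 'I_K
    (fun i j => h1 (h2' (pt (inl (Negz i)))) = pt (inl (Negz j))).
  move=> i; set z := h2' _.
  have h2z : h2 z = pt (inl (Negz i)) by rewrite h2'K.
  have := up2 z; rewrite h2z ptK => upz.
  have [||j zj] := @up_neg_side K (loc (h1 z)).
  (* [z] lies at or above [-K + 1], hence above [-K], and [h1] preserves the latter threshold. *)
  - by rewrite -up1; case: (loc z) upz (ltn_ord i) => //= k; lia.
  - by rewrite side_loc bits h2z.
  - by exists j; rewrite -zj locK.
have sigma_inj : injective sigma.
  move=> i j eij; have /(can_inj h1K)/(can_inj h2'K)/pt_inj[] :
      h1 (h2' (pt (inl (Negz i)))) = h1 (h2' (pt (inl (Negz j)))).
    by rewrite !sigmaP eij.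
  exact: val_inj.
pose x := pt (inl (- K%:Z)%R).
have h2x : up (- K%:Z)%R (loc (h2 x)) = false by rewrite -up2 ptK /=; lia.
have [||j xj] := @up_neg_side K (loc (h1 x)).
- by rewrite -up1 ptK /=.
- rewrite side_loc bits -side_loc; move: h2x.
  by case: (loc (h2 x)) => //= k; lia.
have /codomP[i ji] := injF_onto sigma_inj j.
have /(can_inj h1K) xi : h1 x = h1 (h2' (pt (inl (Negz i)))).
  by rewrite sigmaP -ji -xj locK.
by move: h2x; rewrite xi h2'K ptK /=; have := ltn_ord i; lia.
Qed.

(** Colour the domain of [f] by [P] and that of [g] by [Q]: every step along [f] or [g], forwards or
    backwards, keeps the colour. *)
Lemma Rel_invariant (X : Type) (f g : X -> X) (P Q : X -> bool) (m : int)
    (x y : X) :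
  (forall x, P x = Q (f x)) -> (forall y, Q y = P (g y)) ->
  Rel f g m (x, y) -> P x = Q y.
Proof.
move=> Pf Qg; case: m => n /= ->.
  by rewrite -Pf; elim: n => //= n ->; rewrite -Qg -Pf.
by rewrite -Qg; elim: n => //= n IHn; rewrite -Pf -Qg.
Qed.

(** In the role of [g], with [f] the identity, it misses exactly [-K], so a chain starts at [-K] in
    the domain of [f]. Positions below [-K] close up into cycles. *)
Definition cutL (K : nat) (k : int) : int :=
  if (k < - K%:Z)%R then k else (k + 1)%R.

(** In the role of [f], with [g] the successor, it misses exactly [-K], so a chain starts at [-K] in
    the domain of [g]. *)
Definition cutR (K : nat) (k : int) : int :=
  if (k <= - K%:Z)%R then (k - 1)%R else k.

Theorem theorem58 :
  ~ exists (D : set (baire_space * baire_space))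
           (Phi : baire_space * baire_space -> baire_space * baire_space),
    {within D, continuous Phi} /\
    forall (f g : two_Ninfty -> two_Ninfty) (ef eg : baire_space),
      continuous f -> injective f ->
      continuous g -> injective g ->
      is_code ef f -> is_code eg g ->
      D (ef, eg) /\
      exists h hinv : two_Ninfty -> two_Ninfty,
        [/\ cancel h hinv,
            cancel hinv h,
            is_code (Phi (ef, eg)).1 h,
            is_code (Phi (ef, eg)).2 hinv
          & graph h `<=` \bigcup_(m in [set: int]) Rel f g m].
Proof.
move=> [D [Phi [/subspace_continuousP Phi_cont CSB]]].
pose code psi := code_of (lift psi).
have {}CSB psi phi (psi_inj : injective psi) (phi_inj : injective phi)
    (psi1 : almost_id psi) (phi1 : almost_id phi) :
    D (code psi, code phi) /\ exists h hinv : two_Ninfty -> two_Ninfty,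
      [/\ cancel h hinv, cancel hinv h, is_code (Phi (code psi, code phi)).1 h &
      forall z, exists m, Rel (lift psi) (lift phi) m (z, h z)].
  have [psiM phiM] := (lift_modulus psi1, lift_modulus phi1).
  have [||||||Dpp [h [hinv [hK hinvK codeh _ hR]]]] :=
    CSB (lift psi) (lift phi) (code psi) (code phi).
  - exact: pointwise_modulus_continuous.
  - exact: lift_inj.
  - exact: pointwise_modulus_continuous.
  - exact: lift_inj.
  - exact: code_ofP.
  - exact: code_ofP.
  split=> //; exists h, hinv; split=> // z.
  by have [m _ Rm] := hR (z, h z) erefl; exists m.
pose succ (k : int) := (k + 1)%R.
have succ_inj : injective succ by rewrite /succ => k k'; lia.
have succ1 : almost_id succ by rewrite /succ => k; lia.
have id1 : almost_id id by move=> k /=; lia.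
have cutL_inj K : injective (cutL K).
  by move=> k k'; rewrite /cutL; case: ifP; case: ifP; lia.
have cutL1 K : almost_id (cutL K) by move=> k; rewrite /cutL; case: ifP; lia.
have cutR_inj K : injective (cutR K).
  by move=> k k'; rewrite /cutR; case: ifP; case: ifP; lia.
have cutR1 K : almost_id (cutR K) by move=> k; rewrite /cutR; case: ifP; lia.
have cutL_cvg : code (cutL K) @[K --> \oo] --> code succ.
  apply: code_of_cvg => n; exists n.+1 => // K /= ltnK z.
  by apply: (lift_close (K := K)) => // k; rewrite /cutL /succ; case: ifP; lia.
have cutR_cvg : code (cutR K) @[K --> \oo] --> code id.
  apply: code_of_cvg => n; exists n.+1 => // K /= ltnK z.
  by apply: (lift_close (K := K)) => // k; rewrite /cutR; case: ifP; lia.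
(* The bijection [h0] for the uncut chain is the common reference to which the first bits of [h1]
   and [h2] are compared. *)
have [D0 [h0 [_ [_ _ codeh0 _]]]] :=
  CSB id succ (@inj_id _) succ_inj id1 succ1.
have [M bitM] := first_bit_locally_constant codeh0.
have nearM : \forall p \near (code id, code succ),
    D p -> agree M (Phi p).1 (Phi (code id, code succ)).1.
  have nb1 : nbhs (Phi (code id, code succ)).1
      [set e | agree M e (Phi (code id, code succ)).1].
    by apply: near_agree => i; exact: nbhs_coord.
  apply: (Phi_cont _ D0 [set q | agree M q.1 (Phi (code id, code succ)).1]).
  exact: (@cvg_fst _ _ (nbhs _) (nbhs (Phi (code id, code succ)).2) _ _ nb1).
have nearL : \forall K \near \oo, D (code id, code (cutL K)) ->
    agree M (Phi (code id, code (cutL K))).1 (Phi (code id, code succ)).1.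
  have cvgL : (code id, code (cutL K)) @[K --> \oo] --> (code id, code succ).
    apply: (cvg_pair (G := nbhs (code id)) (H := nbhs (code succ))) => //.
    exact: cvg_cst.
  exact: cvgL nearM.
have nearR : \forall K \near \oo, D (code (cutR K), code succ) ->
    agree M (Phi (code (cutR K), code succ)).1 (Phi (code id, code succ)).1.
  have cvgR : (code (cutR K), code succ) @[K --> \oo] --> (code id, code succ).
    apply: (cvg_pair (G := nbhs (code id)) (H := nbhs (code succ))) => //.
    exact: cvg_cst.
  exact: cvgR nearM.
have [K [agL agR]] := filter_ex (filterI nearL nearR).
have [DL [h1 [h1' [h1K _ code1 R1]]]] :=
  CSB id (cutL K) (@inj_id _) (cutL_inj K) id1 (cutL1 K).
have [DR [h2 [h2' [h2K h2'K code2 R2]]]] :=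
  CSB (cutR K) succ (cutR_inj K) succ_inj (cutR1 K) succ1.
apply: (bijections_first_bit_differ (K := K) h1K h2K h2'K).
- move=> z; have [m] := R1 z.
  (* The chain starting at [-K] in the domain of [f] occupies the positions from [-K] on in both
     copies. *)
  apply: (@Rel_invariant _ _ _ (up (- K%:Z)%R \o loc) (up (- K%:Z)%R \o loc));
    move=> x /=; rewrite loc_lift; case: (loc x) => //= k.
  by rewrite /cutL; case: ifP; lia.
- move=> z; have [m] := R2 z.
  (* Here the chain starts in the domain of [g], so its part in the domain of [f] begins one
     position later. *)
  apply: (@Rel_invariant _ _ _ (up (- K%:Z + 1)%R \o loc)
    (up (- K%:Z)%R \o loc)); move=> x /=; rewrite loc_lift;
    case: (loc x) => //= k.
    by rewrite /cutR; case: ifP; lia.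
  by rewrite /succ; lia.
- by move=> z; rewrite (bitM _ _ code1 (agL DL)) (bitM _ _ code2 (agR DR)).
Qed.
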